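(* For any infinite set $I$, $\kappa_n(\Phi(I))\simeq\sqrt n$, where $\Phi(I)$ is the Fermionic operator space associated to $I$.
   Context: Operator spaces are complex: an operator space is a closed linear subspace $X\subseteq \mathcal B(H)$, $H$ a complex Hilbert space, with $\mathrm M_n(X)$ normed through $\mathrm M_n(X)\subseteq \mathrm M_n(\mathcal B(H))\cong\mathcal B(H^{\oplus n})$. An operator space $X$ is Hilbertian if it is linearly isometric to a Hilbert space, and homogeneous if $\|u\|_{\rm cb}=\|u\|$ for every bounded linear $u\colon X\to X$, where $\|u\|_{\rm cb}=\sup_n\|u_n\|$, $u_n([x_{ij}])=[u(x_{ij})]$. For a homogeneous Hilbertian operator space $X$ with $\dim X\ge n$, $\kappa_n(X)$ is the norm in $\mathrm M_n(X)$ of the matrix whose first column is $(e_1,\dots,e_n)^T$ and whose other entries are $0$, where $\{e_1,\dots,e_n\}$ is any orthonormal set in $X$ (the value does not depend on the choice). Let $H$ be a Hilbert space and $(v_i)_{i\in I}$ a family in $\mathcal B(H)$ such that $v_iv_j+v_jv_i=0$ and $v_iv_j^*+v_j^*v_i=\delta_{i,j}\mathrm{Id}_H$ for all $i,j\in I$. The Fermionic operator space associated to $I$ is $\Phi(I)=\overline{\rm span}\{v_i:i\in I\}$. Known facts: up to complete isometry it depends only on $I$ and not on the choice of $(v_i)$; it is homogeneous and Hilbertian, with $(v_i)_{i\in I}$ an orthonormal basis. For positive sequences, $a_n\simeq b_n$ means there is $L\ge1$ with $a_n/L\le b_n\le La_n$ for all $n\in\mathbb N$. *)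

(* Defs.v *)
From HB Require Import structures.
From mathcomp Require Import all_boot all_order all_algebra.
From mathcomp Require Import all_classical all_reals all_analysis.
From mathcomp Require Import complex.
From mathcomp Require Import ring.

Set Implicit Arguments.
Unset Strict Implicit.
Unset Printing Implicit Defensive.

Import Order.TTheory GRing.Theory Num.Theory.
Import numFieldNormedType.Exports.

Local Open Scope classical_set_scope.
Local Open Scope ring_scope.
Local Open Scope complex_scope.

(* The inner product is linear in its first argument. *)
Record hilbert (R : realType) := Hilbert {
  hsort :> completeNormedModType R[i] ;
  hdot : {dot hsort for Num.conj} ;
  hdotE : forall x : hsort, `|x| ^+ 2 = hdot x x }.

(* Norms of spaces over R[i] take their values in R[i]; rnorm is the same norm
   as a real number. *)
Definition rnorm (R : realType) (V : normedModType R[i]) (x : V) : R :=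
  complex.Re `|x|.

Lemma ge0_ReE (R : realType) (z : R[i]) : 0 <= z -> z = (complex.Re z)%:C.
Proof. by case: z => a b; rewrite lecE /= => /andP[/eqP -> _]. Qed.

Lemma Re_normE (R : realType) (z : R[i]) : (complex.Re `|z|)%:C = `|z|.
Proof. by rewrite -ge0_ReE //; exact: normr_ge0. Qed.

Lemma Re_norm_ge0 (R : realType) (z : R[i]) : 0 <= complex.Re `|z|.
Proof. by rewrite -lecR Re_normE; exact: normr_ge0. Qed.

Section RealNorm.
Variables (R : realType) (V : normedModType R[i]).
Implicit Types x y : V.

Lemma rnormE x : `|x| = (rnorm x)%:C.
Proof. exact: (ge0_ReE (normr_ge0 x)). Qed.

Lemma rnorm_ge0 x : 0 <= rnorm x.
Proof. by rewrite -lecR -rnormE; exact: normr_ge0. Qed.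

Lemma rnorm0 : rnorm (0 : V) = 0.
Proof. by rewrite /rnorm normr0. Qed.

Lemma rnorm0_eq0 x : rnorm x = 0 -> x = 0.
Proof. by move=> x0; apply/eqP; rewrite -normr_eq0 rnormE x0. Qed.

Lemma rnormD x y : rnorm (x + y) <= rnorm x + rnorm y.
Proof. by rewrite -lecR rmorphD /= -!rnormE ler_normD. Qed.

Lemma rnormZ (c : R[i]) x : rnorm (c *: x) = complex.Re `|c| * rnorm x.
Proof.
apply: (@complexI R); rewrite -rnormE normrZ rnormE rmorphM /=.
by rewrite Re_normE.
Qed.

End RealNorm.

Section BoundedOperators.
Variables (R : realType) (H : hilbert R).

Definition bounded_op : {pred (H -> H)} := fun f =>
  `[< linear f /\ exists M : R, forall x, rnorm (f x) <= M * rnorm x >].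

Lemma bounded_op_submod : submod_closed bounded_op.
Proof.
split.
  apply/asboolP; split.
    by move=> a x y; rewrite -[RHS]/(a *: (0 : H) + 0) scaler0 addr0.
  by exists 0 => x; rewrite mul0r -[X in rnorm X]/(0 : H) rnorm0.
move=> a f g /asboolP[fl [M fM]] /asboolP[gl [N gN]]; apply/asboolP; split.
  move=> b x y; rewrite !fctE fl gl !scalerDr !scalerA (mulrC a b).
  by rewrite addrACA.
exists (complex.Re `|a| * M + N) => x.
apply: (le_trans (rnormD _ _)).
rewrite mulrDl lerD// rnormZ -mulrA ler_wpM2l//.
exact: Re_norm_ge0.
Qed.

HB.instance Definition _ :=
  GRing.isSubmodClosed.Build _ _ bounded_op bounded_op_submod.

Record bop := BOp { bop_fun :> H -> H ; _ : bop_fun \in bounded_op }.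

HB.instance Definition _ := [isSub for bop_fun].
HB.instance Definition _ := [Choice of bop by <:].
HB.instance Definition _ := [SubChoice_isSubLmodule of bop by <:].

Definition opnorm (f : bop) : R :=
  sup [set rnorm (f x) | x in [set x : H | rnorm x <= 1]].

Lemma bop_linear (f : bop) : linear f.
Proof. by case: f => f /= /asboolP[]. Qed.

Lemma bop0 (f : bop) : f 0 = 0.
Proof. by have := bop_linear f (-1) 0 0; rewrite scaler0 addr0 scaleN1r addNr. Qed.

Lemma bopZ (f : bop) c x : f (c *: x) = c *: f x.
Proof. by have := bop_linear f c x 0; rewrite !addr0 bop0 addr0. Qed.

Lemma opnorm_has_sup (f : bop) :
  has_sup [set rnorm (f x) | x in [set x : H | rnorm x <= 1]].
Proof.
split; first by exists (rnorm (f 0)), 0 => //=; rewrite rnorm0.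
case: f => f /= /asboolP[fl [M fM]]; exists (Num.max M 0) => _ [x /= x1 <-].
apply: (le_trans (fM x)); case: (leP M 0) => M0.
  by rewrite mulr_le0_ge0 ?rnorm_ge0.
by rewrite ler_piMr // ltW.
Qed.

Lemma opnorm_ub (f : bop) x : rnorm x <= 1 -> rnorm (f x) <= opnorm f.
Proof. by move=> x1; apply: (ub_le_sup (opnorm_has_sup f).2); exists x. Qed.

Lemma opnorm_le (f : bop) (M : R) :
  (forall x, rnorm x <= 1 -> rnorm (f x) <= M) -> opnorm f <= M.
Proof.
move=> fM; apply: ge_sup; first exact: (opnorm_has_sup f).1.
by move=> _ [x /= x1 <-]; exact: fM.
Qed.

Lemma opnorm_ge0 (f : bop) : 0 <= opnorm f.
Proof.
by apply: (le_trans (rnorm_ge0 (f 0))); apply: opnorm_ub; rewrite rnorm0.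
Qed.

Lemma opnormD (f g : bop) : opnorm (f + g) <= opnorm f + opnorm g.
Proof.
apply: opnorm_le => x x1; apply: (le_trans (rnormD _ _)).
by rewrite lerD ?opnorm_ub.
Qed.

Let opnormZ_le (c : R[i]) (f : bop) :
  opnorm (c *: f) <= complex.Re `|c| * opnorm f.
Proof.
apply: opnorm_le => x x1; rewrite [X in rnorm X]/(c *: f x) rnormZ.
by rewrite ler_wpM2l ?opnorm_ub ?Re_norm_ge0.
Qed.

Lemma opnormZ (c : R[i]) (f : bop) :
  opnorm (c *: f) = complex.Re `|c| * opnorm f.
Proof.
apply/eqP; rewrite eq_le opnormZ_le andTb.
have [->|c0] := eqVneq c 0; first by rewrite normr0 mul0r opnorm_ge0.
have c_gt0 : 0 < complex.Re `|c|.
  by rewrite -ltcR Re_normE normr_gt0.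
rewrite -ler_pdivlMl //; have := opnormZ_le c^-1 (c *: f).
rewrite scalerA mulVf // scale1r; congr (_ <= _ * _).
by apply: (@complexI R); rewrite Re_normE fmorphV /= Re_normE normfV.
Qed.

Lemma opnorm0_eq0 (f : bop) : opnorm f = 0 -> f = 0.
Proof.
move=> f0; apply/val_inj/funext => x; rewrite -[RHS]/(0 : H) /=.
have [->|x0] := eqVneq x 0; first exact: bop0.
have nx0 : `|x| != 0 by rewrite normr_eq0.
rewrite -[x](scalerKV nx0) bopZ.
suff -> : f (`|x|^-1 *: x) = 0 by rewrite scaler0.
apply/rnorm0_eq0/le_anti; rewrite rnorm_ge0 -[X in _ <= X]f0 opnorm_ub //.
by rewrite -lecR -rnormE normrZ normfV normr_id mulVf.
Qed.

Let bnorm (f : bop) : R[i] := (opnorm f)%:C.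

Let bnormD f g : bnorm (f + g) <= bnorm f + bnorm g.
Proof. by rewrite /bnorm -rmorphD lecR opnormD. Qed.

Let bnormZ c f : bnorm (c *: f) = `|c| * bnorm f.
Proof. by rewrite /bnorm opnormZ rmorphM /= Re_normE. Qed.

Let bnorm0_eq0 f : bnorm f = 0 -> f = 0.
Proof. by move=> /complexI /opnorm0_eq0. Qed.

HB.instance Definition _ :=
  Lmodule_isNormed.Build R[i] bop bnormD bnormZ bnorm0_eq0.

Lemma bop_normE (f : bop) : `|f| = (opnorm f)%:C.
Proof. by []. Qed.

End BoundedOperators.

Notation "''B' ( H )" := (bop H) (at level 8, format "''B' ( H )").

Record opspace (R : realType) (H : hilbert R) := OpSpace {
  os_set :> set 'B(H) ;
  os_set0 : os_set 0 ;
  os_lin : forall (a : R[i]) (f g : 'B(H)),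
    os_set f -> os_set g -> os_set (a *: f + g) ;
  os_closed : closed os_set }.

(* M_n(B(H)) is normed as B(H^n), where H^n carries the Hilbert direct sum
   norm l2norm and a matrix acts on column vectors; for an operator space X in
   B(H), M_n(X) carries the restriction of this norm. *)
Section MatrixNorm.
Variables (R : realType) (H : hilbert R) (n : nat).

Definition l2norm (x : 'I_n -> H) : R :=
  Num.sqrt (\sum_(i < n) rnorm (x i) ^+ 2).

Definition mxact (a : 'M['B(H)]_n) (x : 'I_n -> H) : 'I_n -> H :=
  fun i => \sum_(j < n) a i j (x j).

Definition mxnorm (a : 'M['B(H)]_n) : R :=
  sup [set l2norm (mxact a x) | x in [set x | l2norm x <= 1]].

Definition first_col (e : 'I_n -> 'B(H)) : 'M['B(H)]_n :=
  \matrix_(i < n, j < n) if j == 0%N :> nat then e i else 0.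

End MatrixNorm.

(* In a Hilbertian space the inner product transported from a Hilbert space is
   determined by the norm through the polarization identity, see
   polar_isometry. *)
Definition polar (R : realType) (V : normedModType R[i]) (x y : V) : R[i] :=
  4^-1 * (`|x + y| ^+ 2 - `|x - y| ^+ 2
          + 'i%R * (`|x + 'i%R *: y| ^+ 2 - `|x - 'i%R *: y| ^+ 2)).

Lemma polar_isometry (R : realType) (K : hilbert R) (V : normedModType R[i])
    (T : K -> V) : linear T -> (forall x, `|T x| = `|x|) ->
  forall x y, polar (T x) (T y) = hdot K x y.
Proof.
move=> Tlin Tiso x y.
have TD u w : T u + T w = T (u + w).
  by rewrite -[T u]scale1r -Tlin scale1r.
have T0 : T 0 = 0 by have := Tlin (-1) 0 0; rewrite scaler0 addr0 scaleN1r addNr.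
have TZ a u : a *: T u = T (a *: u) by have := Tlin a u 0; rewrite T0 !addr0.
have TB u w : T u - T w = T (u - w) by rewrite -scaleN1r TZ TD scaleN1r.
rewrite /polar !TZ !TD !TB !Tiso !hdotE !dnormD !hnormN !linearNr.
rewrite !linearZr_LR /= !rmorphN !rmorphM /= !conjCK conjCi.
set d := hdot K x y; set N := hdot K x x; set M := hdot K y y.
set P := hdot K ('i%R *: y) ('i%R *: y); move: (d^*)%R => d'.
have ii : 'i%R * 'i%R = -1 :> R[i] by rewrite -expr2 sqrCi.
have n4 : 4%:R != 0 :> R[i] by rewrite pnatr_eq0.
rewrite -[RHS](mulKf n4); congr (_ * _).
apply/eqP; rewrite -subr_eq0; apply/eqP.
transitivity (2%:R * ('i%R * 'i%R + 1) * (d' - d)); first by ring.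
by rewrite ii addNr mulr0 mul0r.
Qed.

Section Kappa.
Variables (R : realType) (H : hilbert R) (X : opspace H) (n : nat).

Definition orthonormal_in (e : 'I_n -> 'B(H)) : Prop :=
  (forall i, os_set X (e i)) /\ (forall i j, polar (e i) (e j) = (i == j)%:R).

Definition is_kappa (k : R) : Prop :=
  (exists e, orthonormal_in e) /\
  (forall e, orthonormal_in e -> mxnorm (first_col e) = k).

(* The common value of the norm of first_col e over all orthonormal e; it is 0
   if there is no such value, which does not happen for a homogeneous
   Hilbertian X of dimension at least n. *)
Definition kappa : R := xget 0 [set k | is_kappa k].

End Kappa.

(* The Hilbert space adjoint; it is unique, and exists by the Riesz
   representation theorem. *)
Definition adj (R : realType) (H : hilbert R) (f : 'B(H)) : 'B(H) :=
  xget 0 [set g : 'B(H) | forall x y, hdot H (f x) y = hdot H x (g y)].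

Definition car_family (R : realType) (H : hilbert R) (I : Type)
    (v : I -> 'B(H)) : Prop :=
  forall (i j : I) (x : H),
    v i (v j x) + v j (v i x) = 0 /\
    v i (adj (v j) x) + adj (v j) (v i x) = `[< i = j >]%:R *: x.

Definition lin_span (R : realType) (V : lmodType R[i]) (I : Type)
    (v : I -> V) : set V :=
  [set f | exists s : seq (R[i] * I), f = \sum_(p <- s) p.1 *: v p.2].

Section Fermionic.
Variables (R : realType) (H : hilbert R) (I : Type) (v : I -> 'B(H)).

Let Phi := closure (lin_span v).

Let Phi0 : Phi 0.
Proof.
by apply: subset_closure; exists [::]; rewrite big_nil.
Qed.

Let Phi_lin (a : R[i]) (f g : 'B(H)) : Phi f -> Phi g -> Phi (a *: f + g).
Proof.
move=> Phif Phig B /= nB.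
have : (fun z : 'B(H) * 'B(H) => a *: z.1 + z.2) @ nbhs (f, g) --> a *: f + g.
  by apply: cvgD; [apply: cvgZl_tmp|]; [exact: cvg_fst|exact: cvg_snd].
move=> /(_ B nB) [[U W]/= [nU nW]] UW.
have [f' [[s ->] Us]] := Phif U nU.
have [g' [[t ->] Wt]] := Phig W nW.
exists (a *: (\sum_(p <- s) p.1 *: v p.2) + \sum_(p <- t) p.1 *: v p.2).
split; last by have := UW (_, _) (conj Us Wt).
exists ([seq (a * p.1, p.2) | p <- s] ++ t).
rewrite big_cat big_map scaler_sumr; congr (_ + _).
by apply: eq_bigr => p _; rewrite scalerA.
Qed.

Definition fermionic : opspace H :=
  OpSpace Phi0 Phi_lin (@closed_closure _ _).

End Fermionic.

(* The sequences are indexed by the positive integers. *)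
Definition asymp_equiv (R : realType) (a b : nat -> R) : Prop :=
  exists L : R, 1 <= L /\
    forall n, (0 < n)%N -> a n / L <= b n /\ b n <= L * a n.

(* Main.v *)
Require Import Defs.
From mathcomp Require Import all_boot all_order all_algebra.
From mathcomp Require Import all_classical all_reals all_analysis.
From mathcomp Require Import complex.
From mathcomp Require Import ring.

Set Implicit Arguments.
Unset Strict Implicit.
Unset Printing Implicit Defensive.

Import Order.TTheory GRing.Theory Num.Theory.
Local Open Scope classical_set_scope.
Local Open Scope ring_scope.

(** For every positive n the value of kappa_n is exactly the square root of n.

    The norm of the column with entries e_1, ..., e_n is the supremum, over unit
    vectors y, of the square root of the sum of the squares of |e_i y|.  An
    orthonormal e_i has norm 1, so this is at most sqrt n; the point is that a
    single y comes arbitrarily close to norming all the e_i at once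
    ([fermionic_norming]).

    Suppose first that the e_i lie in the linear span of the v_i.  Each e_i
    then has an adjoint g_i, the g_i anticommute and square to 0, and
    e_i g_i + g_i e_i is a scalar c_i ([comb_car], [comb_car_star]).  A family
    of anticommuting operators of square zero has a common kernel vector y <> 0
    ([common_kernel]): starting from any nonzero vector, apply in turn each
    operator that does not already kill it.  Pairing the scalar relation with x
    gives |e_i x|^2 + |g_i x|^2 = c_i |x|^2, so that |e_i| <= sqrt c_i, with
    equality reached at y because g_i y = 0 ([norming_of_adjoint_kernel]).
    Physically, y is the state in which all the modes e_i are occupied.
    Elements of the closure are handled by norm approximation alone, so no
    adjoint of a limit has to be constructed.

    The same computation gives |sum_i a_i v_i|^2 = sum_i |a_i|^2
    for distinct indices ([opnorm_comb]), hence by polarization the v_i are orthonormal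
    ([polar_car]); since the index set is infinite, orthonormal families of
    every size exist, and kappa_n is not the default value. *)

(** * Operators with an adjoint *)

Section Operators.
Context {R : realType} {H : hilbert R}.
Implicit Types (f g h : 'B(H)) (x y z : H).

Definition adjoint_of f g := forall x y, hdot H (f x) y = hdot H x (g y).

Lemma hdotC x y : hdot H x y = (hdot H y x)^*.
Proof. by rewrite hermC expr0 mul1r. Qed.

Lemma adjoint_ofC f g : adjoint_of f g -> adjoint_of g f.
Proof. by move=> fg x y; rewrite hdotC -fg -hdotC. Qed.

Lemma bopD f x y : f (x + y) = f x + f y.
Proof. by have := bop_linear f 1 x y; rewrite !scale1r. Qed.

Lemma bop_sum f (J : Type) (r : seq J) (F : J -> H) :
  f (\sum_(i <- r) F i) = \sum_(i <- r) f (F i).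
Proof. by apply: (big_morph f (bopD f)); exact: bop0. Qed.

Lemma sum_bopE (J : Type) (r : seq J) (F : J -> 'B(H)) x :
  (\sum_(i <- r) F i) x = \sum_(i <- r) F i x.
Proof. by apply: (big_morph (fun f : 'B(H) => f x)). Qed.

Lemma rnormB_ge f g x : rnorm x <= 1 ->
  rnorm (g x) - opnorm (f - g) <= rnorm (f x).
Proof.
move=> x1; rewrite lerBlDr; have := opnorm_ub (f - g) x1.
rewrite -[X in rnorm X <= _]/(f x - g x) => fg.
have -> : rnorm (g x) = rnorm (f x - (f x - g x)).
  by congr rnorm; rewrite opprB addrC subrK.
apply: (le_trans (rnormD _ _)); rewrite lerD2l.
by apply: le_trans fg; rewrite /rnorm normrN.
Qed.

Lemma rnorm_bop f x : rnorm (f x) <= opnorm f * rnorm x.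
Proof.
have [->|x0] := eqVneq x 0; first by rewrite bop0 rnorm0 mulr0.
have nx0 : `|x| != 0 by rewrite normr_eq0.
have rx : 0 < rnorm x by rewrite -ltcR -rnormE normr_gt0.
rewrite -ler_pdivrMr//.
have e y : rnorm (`|x|^-1 *: y) = rnorm y / rnorm x.
  rewrite rnormZ mulrC; congr (_ * _).
  by apply: (@complexI R); rewrite Re_normE normfV normr_id rnormE -fmorphV.
by rewrite -e -bopZ opnorm_ub// e divff// gt_eqF.
Qed.

Lemma rnorm_sqr x : (rnorm x ^+ 2)%:C%C = hdot H x x.
Proof. by rewrite -hdotE rnormE rmorphXn. Qed.

Lemma addrr_eq0 x : x + x = 0 -> x = 0.
Proof.
move/eqP; rewrite -mulr2n -scaler_nat scaler_eq0 pnatr_eq0 /=.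
by move/eqP.
Qed.

Lemma adjoint_anticomm f1 f2 g1 g2 : adjoint_of f1 g1 -> adjoint_of f2 g2 ->
  (forall x, f1 (f2 x) + f2 (f1 x) = 0) -> forall x, g1 (g2 x) + g2 (g1 x) = 0.
Proof.
move=> a1 a2 f12 x; apply/eqP; rewrite -(dnorm_eq0 (hdot H)).
set y := (X in hdot H X _ == _).
by rewrite linearDr /= -a1 -a2 -a2 -a1 -linearDl /= addrC f12 linear0l.
Qed.

(** Passing from x to g x destroys nothing: every h that kills x still kills
    g x, because h g x = - g h x, and g itself kills g x since g squares to 0. *)
Lemma common_kernel (H_neq0 : exists x : H, x != 0) (gs : seq 'B(H)) :
  {in gs &, forall g h, forall x, g (h x) + h (g x) = 0} ->
  exists2 x : H, x != 0 & {in gs, forall g, g x = 0}.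
Proof.
elim: gs => [_|g gs IH gsP]; first by case: H_neq0 => x x0; exists x.
have [g1 h1 g1s h1s|x x0 xP] := IH.
  by apply: gsP; rewrite in_cons ?g1s ?h1s orbT.
have [gx0|gx0] := eqVneq (g x) 0.
  by exists x => // h; rewrite in_cons => /orP[/eqP ->|/xP].
exists (g x) => // h; rewrite in_cons => /orP[/eqP ->|hs].
  by apply: addrr_eq0; apply: gsP; rewrite mem_head.
have hg : h (g x) + g (h x) = 0 by apply: gsP; rewrite in_cons ?hs ?eqxx ?orbT.
by move: hg; rewrite (xP h hs) bop0 addr0.
Qed.

(** Both squared norms are inner products against x: <g f x, x> and <f g x, x>. *)
Lemma sqnorm_adjoint_anticomm f g c : adjoint_of f g ->
  (forall x, f (g x) + g (f x) = c *: x) -> forall x,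
  (rnorm (f x) ^+ 2 + rnorm (g x) ^+ 2)%:C%C = c * (rnorm x ^+ 2)%:C%C.
Proof.
move=> fg fgc x; rewrite rmorphD /= !rnorm_sqr -(adjoint_ofC fg) -[X in _ + X]fg.
by rewrite -linearDl addrC fgc linearZl_LR.
Qed.

(** By [sqnorm_adjoint_anticomm], sqrt c is an upper bound for the norm of f,
    and it is reached at z, where the term |g z|^2 vanishes. *)
Lemma norming_of_adjoint_kernel f g c z : adjoint_of f g ->
  (forall x, f (g x) + g (f x) = c *: x) -> z != 0 -> g z = 0 ->
  c = (opnorm f ^+ 2)%:C%C /\ rnorm (f z) = opnorm f * rnorm z.
Proof.
move=> fg fgc z0 gz0; have py := sqnorm_adjoint_anticomm fg fgc.
have rz : 0 < rnorm z by rewrite -ltcR -rnormE normr_gt0.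
pose r := rnorm (f z) / rnorm z.
have r_ge0 : 0 <= r by rewrite divr_ge0 ?rnorm_ge0.
have cE : c = (r ^+ 2)%:C%C.
  have := py z; rewrite gz0 rnorm0 expr0n addr0
    => /(congr1 ( *%R^~ ((rnorm z ^+ 2)^-1)%:C%C)).
  rewrite -mulrA -!rmorphM /= divff ?sqrf_eq0 ?gt_eqF// mulr1 => <-.
  by rewrite /r expr_div_n.
suff rE : opnorm f = r by rewrite rE cE /r divfK ?gt_eqF.
apply/eqP; rewrite eq_le ler_pdivrMr// rnorm_bop andbT.
apply: opnorm_le => x x1; have := py x; rewrite cE -rmorphM /= => /complexI fx.
rewrite -(@ler_pXn2r _ 2) ?nnegrE ?rnorm_ge0//.
apply: (@le_trans _ _ (r ^+ 2 * rnorm x ^+ 2)).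
  by rewrite -fx lerDl sqr_ge0.
by rewrite ler_piMr ?sqr_ge0// expr_le1 ?rnorm_ge0.
Qed.

(** The elements of [lin_span v], as a function of the list of their terms; an
    index may occur several times in the list. *)
Definition comb (I : Type) (v : I -> 'B(H)) (s : seq (R[i] * I)) : 'B(H) :=
  \sum_(p <- s) p.1 *: v p.2.

Lemma combE (I : Type) (v : I -> 'B(H)) s x :
  comb v s x = \sum_(p <- s) p.1 *: v p.2 x.
Proof. exact: sum_bopE. Qed.

(** Used with f = v_i and then with f a combination, this extends a relation
    between the v_i bilinearly to their combinations. *)
Lemma comb_anticomm (I : Type) (f : 'B(H)) (v : I -> 'B(H)) (c : I -> R[i]) s :
  (forall i x, f (v i x) + v i (f x) = c i *: x) ->
  forall x, f (comb v s x) + comb v s (f x) = (\sum_(p <- s) p.1 * c p.2) *: x.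
Proof.
move=> fv x; rewrite !combE bop_sum -big_split /= scaler_suml.
by apply: eq_bigr => p _; rewrite bopZ -scalerDr fv scalerA.
Qed.

Definition conj_coef (I : Type) (s : seq (R[i] * I)) :=
  [seq (p.1^*, p.2) | p <- s].

Lemma adjoint_comb (I : Type) (v w : I -> 'B(H)) s :
  (forall i, adjoint_of (v i) (w i)) ->
  adjoint_of (comb v s) (comb w (conj_coef s)).
Proof.
move=> vw x y; rewrite !combE big_map linear_sumlz linear_sumr.
by apply: eq_bigr => p _; rewrite linearZl_LR linearZr_LR /= conjCK vw.
Qed.

End Operators.

(** * The polar form *)

(** In a Hilbert space the coefficients a, b, t, t' would be <x, x>, <y, y>,
    <x, y> and <y, x>: the polar form can be read off the squared norms of
    the vectors x + c y. *)
Lemma polar_of_sqnorm (R : realType) (V : normedModType R[i]) (x y : V)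
    (a b t t' : R[i]) :
  (forall c : R[i], `|x + c *: y| ^+ 2 = a + c * c^* * b + c^* * t + c * t') ->
  polar x y = t.
Proof.
move=> xy; have ii : 'i%R * 'i%R = -1 :> R[i] by rewrite -expr2 sqrCi.
have n4 : 4%:R != 0 :> R[i] by rewrite pnatr_eq0.
have y1 : x + y = x + 1 *: y by rewrite scale1r.
have yN1 : x - y = x + (-1) *: y by rewrite scaleN1r.
have yNi : x - 'i%R *: y = x + (- 'i%R) *: y by rewrite scaleNr.
rewrite /polar y1 yN1 yNi !xy !rmorphN /= conjC1 conjCi.
rewrite -[RHS](mulKf n4); congr (_ * _).
apply/eqP; rewrite -subr_eq0; apply/eqP.
transitivity (2%:R * ('i%R * 'i%R + 1) * (t' - t)); first by ring.
by rewrite ii addNr mulr0 mul0r.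
Qed.

Lemma polarxx (R : realType) (V : normedModType R[i]) (x : V) :
  polar x x = `|x| ^+ 2.
Proof.
apply: (@polar_of_sqnorm _ _ _ _ (`|x| ^+ 2) (`|x| ^+ 2) _ (`|x| ^+ 2)) => c.
rewrite -{1}[x]scale1r -scalerDl normrZ exprMn normCK rmorphD /= conjC1.
by ring.
Qed.

(** * Linear combinations of a CAR family *)

Section CAR.
Context {R : realType} {H : hilbert R} {I : Type} (v : I -> 'B(H)).
Hypotheses (H_neq0 : exists x : H, x != 0) (v_car : car_family v).
Implicit Types s t : seq (R[i] * I).

(** [adj] returns 0 when there is no adjoint; the relation
    v_i v_i^* + v_i^* v_i = 1 would then read 0 = 1, which fails on a nonzero
    space.  So the relations themselves provide the adjoint, without the
    Riesz representation theorem. *)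
Lemma adjoint_adj i : adjoint_of (v i) (adj (v i)).
Proof.
have [ex|nex] := pselect (exists g, adjoint_of (v i) g).
  exact: (xgetPex 0 ex).
have adj0 : adj (v i) = 0 by apply: xgetPN => g gP; apply: nex; exists g.
case: H_neq0 => x /eqP[]; have [_] := v_car i i x.
by rewrite adj0 asboolT// scale1r bop0 addr0.
Qed.

Let vadj i := adj (v i).
Let star s := comb vadj (conj_coef s).

Lemma comb_car s t x : comb v s (comb v t x) + comb v t (comb v s x) = 0.
Proof.
rewrite (@comb_anticomm _ _ _ _ _ (fun=> 0)) => [|i y].
  by rewrite big1 ?scale0r// => p _; rewrite mulr0.
rewrite addrC (@comb_anticomm _ _ _ _ _ (fun=> 0)) => [|j z].
  by rewrite big1// => p _; rewrite mulr0.
by rewrite scale0r (v_car i j z).1.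
Qed.

(** The coordinate inner product, with repeated indices taken into account: the
    terms of the two lists are compared pairwise. *)
Definition comb_dot s t : R[i] :=
  \sum_(q <- t) q.1^* * \sum_(p <- s) p.1 * `[< p.2 = q.2 >]%:R.

Lemma comb_car_star s t x :
  comb v s (star t x) + star t (comb v s x) = comb_dot s t *: x.
Proof.
rewrite (@comb_anticomm _ _ _ _ _
  (fun j => \sum_(p <- s) p.1 * `[< p.2 = j >]%:R)) => [|j y].
  by rewrite big_map.
rewrite addrC (@comb_anticomm _ _ _ _ _ (fun i => `[< i = j >]%:R))// => i z.
by rewrite addrC (v_car i j z).2.
Qed.

(** The relations v_i v_j + v_j v_i = 0 pass to the adjoints, hence to their
    linear combinations, to which [common_kernel] applies. *)
Lemma star_kernel n (s : 'I_n -> seq (R[i] * I)) :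
  exists2 y : H, rnorm y = 1 & forall i, star (s i) y = 0.
Proof.
have [|y y0 yP] := @common_kernel _ _ H_neq0 [seq star (s i) | i : 'I_n].
  move=> _ _ /codomP[i ->] /codomP[j ->].
  by apply: adjoint_anticomm (comb_car _ _); apply: adjoint_comb adjoint_adj.
exists (`|y|^-1 *: y) => [|i].
  by rewrite /rnorm normrZ normfV normr_id mulVf ?normr_eq0.
by rewrite bopZ yP ?scaler0//; apply: codom_f.
Qed.

Lemma rnorm1_neq0 (y : H) : rnorm y = 1 -> y != 0.
Proof. by apply: contra_eq_neq => ->; rewrite rnorm0 eq_sym oner_neq0. Qed.

Lemma comb_norming n (s : 'I_n -> seq (R[i] * I)) :
  exists2 y : H, rnorm y = 1 &
    forall i, rnorm (comb v (s i) y) = opnorm (comb v (s i)).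
Proof.
have [y y1 yP] := star_kernel s; exists y => // i.
have [_ ->] := norming_of_adjoint_kernel (adjoint_comb _ adjoint_adj)
  (comb_car_star _ _) (rnorm1_neq0 y1) (yP i).
by rewrite y1 mulr1.
Qed.

Lemma opnorm_comb s : (opnorm (comb v s) ^+ 2)%:C%C = comb_dot s s.
Proof.
have [y y1 yP] := @star_kernel 1 (fun=> s).
by have [->] := norming_of_adjoint_kernel (adjoint_comb _ adjoint_adj)
  (comb_car_star _ _) (rnorm1_neq0 y1) (yP ord0).
Qed.

Lemma polar_car i j : polar (v i) (v j) = `[< i = j >]%:R.
Proof.
(* With t the value of [i = j], the norm formula for the two terms v_i and
   c v_j reads 1 + |c|^2 + conj(c) t + c t. *)
have d_sym : `[< j = i >] = `[< i = j >] by apply: asbool_equiv_eq; split=> ->.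
apply: (@polar_of_sqnorm _ _ _ _ 1 1 _ `[< i = j >]%:R) => c.
have -> : v i + c *: v j = comb v [:: (1, i); (c, j)].
  by rewrite /comb big_cons big_seq1 scale1r.
rewrite bop_normE -rmorphXn /= opnorm_comb /comb_dot !(big_cons, big_nil) /=.
rewrite d_sym !(asboolT (erefl _)) conjC1 !mul1r !addr0 mulr1n.
move: (_%:R) => t; ring.
Qed.

End CAR.

(** * The norm of a column *)

Section Column.
Context {R : realType} {H : hilbert R}.

Lemma rnorm_le_l2norm n (x : 'I_n -> H) i : rnorm (x i) <= l2norm x.
Proof.
rewrite -(ger0_norm (rnorm_ge0 (x i))) -sqrtr_sqr ler_wsqrtr//.
by rewrite (bigD1 i)//= lerDl sumr_ge0// => j _; rewrite sqr_ge0.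
Qed.

Lemma mxact_first_col n (e : 'I_n.+1 -> 'B(H)) x i :
  mxact (first_col e) x i = e i (x ord0).
Proof.
rewrite /mxact big_ord_recl mxE /= big1 ?addr0// => j _.
by rewrite mxE.
Qed.

(** The bound sqrt n follows from the norms of the e_i alone; a column (y, 0, ...)
    with y almost norming all the e_i at the same time shows that it is sharp. *)
Lemma mxnorm_first_col n (e : 'I_n.+1 -> 'B(H)) :
  (forall i, opnorm (e i) = 1) ->
  (forall d, 0 < d -> exists2 y : H, rnorm y = 1 &
     forall i, 1 - d <= rnorm (e i y)) ->
  mxnorm (first_col e) = Num.sqrt n.+1%:R.
Proof.
move=> e1 e_norming.
pose S := [set l2norm (mxact (first_col e) x) | x in [set x | l2norm x <= 1]].
have ub : ubound S (Num.sqrt n.+1%:R).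
  move=> _ [x /= x1 <-]; rewrite /l2norm ler_wsqrtr//.
  have -> : n.+1%:R = \sum_(i < n.+1) (1 : R) by rewrite sumr_const card_ord.
  apply: ler_sum => i _.
  rewrite mxact_first_col expr_le1 ?rnorm_ge0// -(e1 i) opnorm_ub//.
  exact: le_trans (rnorm_le_l2norm _ _) x1.
have S0 : S !=set0.
  exists (l2norm (mxact (first_col e) (fun=> 0))), (fun=> 0) => //=.
  by rewrite /l2norm big1 ?sqrtr0// => i _; rewrite rnorm0 expr0n.
apply/eqP; rewrite eq_le ge_sup//=; apply/ler_addgt0Pr => eps eps0.
have n0 : 0 < Num.sqrt n.+1%:R :> R by rewrite sqrtr_gt0.
(* The minimum with 1 keeps 1 - d nonnegative, so that it can be squared. *)
pose d := Num.min 1 (eps / Num.sqrt n.+1%:R).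
have d0 : 0 < d by rewrite lt_min ltr01 divr_gt0.
have d1 : 0 <= 1 - d by rewrite subr_ge0 ge_min lexx.
have [y y1 ey] := e_norming d d0.
apply: (@le_trans _ _ ((1 - d) * Num.sqrt n.+1%:R + eps)).
  rewrite mulrBl mul1r -addrA lerDl addrC subr_ge0 -ler_pdivlMr//.
  by rewrite ge_min lexx orbT.
rewrite lerD2r.
pose x (i : 'I_n.+1) := if i == ord0 then y else 0.
apply: (@le_trans _ _ (l2norm (mxact (first_col e) x))); last first.
  apply: ub_le_sup; first by exists (Num.sqrt n.+1%:R).
  exists x => //=; rewrite /l2norm (bigD1 ord0)//= {1}/x eqxx y1 expr1n.
  by rewrite big1 ?addr0 ?sqrtr1// => i /negPf i0; rewrite /x i0 rnorm0 expr0n.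
rewrite -(ger0_norm d1) -sqrtr_sqr -sqrtrM ?sqr_ge0// ler_wsqrtr//.
rewrite mulr_natr.
have -> : (1 - d) ^+ 2 *+ n.+1 = \sum_(i < n.+1) (1 - d) ^+ 2.
  by rewrite sumr_const card_ord.
apply: ler_sum => i _.
by rewrite mxact_first_col /x eqxx lerXn2r ?nnegrE ?rnorm_ge0.
Qed.

End Column.

(** * The fermionic operator space *)

Section Kappa.
Context {R : realType} {H : hilbert R} {I : Type} {v : I -> 'B(H)}.
Hypotheses (H_neq0 : exists x : H, x != 0) (v_car : car_family v).

(** Approximate each e_i within d / 2 by a combination of the v_i, and take the
    vector norming these combinations: half of d is lost in passing from the
    norm of e_i to that of its approximation, and half at the vector. *)
Lemma fermionic_norming n (e : 'I_n -> 'B(H)) (d : R) : 0 < d ->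
  (forall i, os_set (fermionic v) (e i)) ->
  exists2 y : H, rnorm y = 1 & forall i, opnorm (e i) - d <= rnorm (e i y).
Proof.
move=> d0 ePhi; have d20 : 0 < d / 2 by rewrite divr_gt0.
have approx i : exists s, opnorm (e i - comb v s) < d / 2.
  have /ePhi[_ [[s ->] es]] : nbhs (e i) (ball (e i) (d / 2)%:C%C).
    by apply: nbhsx_ballx; rewrite ltcR.
  by exists s; rewrite -ltcR; move: es; rewrite -ball_normE.
have [s sP] := choice approx.
have [y y1 yP] := comb_norming H_neq0 v_car s.
exists y => // i; have y_le1 : rnorm y <= 1 by rewrite y1.
apply: le_trans (rnormB_ge (e i) (comb v (s i)) y_le1).
rewrite yP [d]splitr opprD addrA; apply: lerB; last exact: ltW.
rewrite lerBlDr; apply: (le_trans _ (lerD (lexx _) (ltW (sP i)))).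
by rewrite -{1}[e i](subrK (comb v (s i))) addrC opnormD.
Qed.

Lemma kappa_fermionic (I_infinite : infinite_set [set: I]) n : (0 < n)%N ->
  kappa (fermionic v) n = Num.sqrt n%:R.
Proof.
case: n => // n _.
have norm (e : 'I_n.+1 -> 'B(H)) : orthonormal_in (fermionic v) e ->
    mxnorm (first_col e) = Num.sqrt n.+1%:R.
  move=> [ePhi e_polar].
  have e1 i : opnorm (e i) = 1.
    have : `|e i| ^+ 2 = 1 by rewrite -polarxx e_polar eqxx.
    rewrite bop_normE -rmorphXn => /complexI /eqP.
    by rewrite sqrp_eq1 ?opnorm_ge0// => /eqP.
  apply: mxnorm_first_col => // d d0.
  have [y y1 yP] := fermionic_norming d0 ePhi; exists y => // i.
  by rewrite -(e1 i).
have [f f_inj] : exists f : nat -> I, injective f.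
  have /card_leP[f] := (infiniteP _).1 I_infinite.
  pose in_nat k : [set: nat] := SigSub (mem_set (Logic.I : [set: nat] k)).
  exists (fun k => \val (f (in_nat k))) => j k /val_inj fjk.
  have : in_nat j = in_nat k by apply: inj fjk; rewrite inE.
  by move=> /(congr1 val).
pose e (i : 'I_n.+1) := v (f i).
have eP : orthonormal_in (fermionic v) e.
  split=> [i|i j].
    by apply: subset_closure; exists [:: (1, f i)]; rewrite big_seq1 scale1r.
  rewrite /e (polar_car H_neq0 v_car).
  have [->|ij] := eqVneq i j; first by rewrite asboolT.
  by rewrite asboolF// => fij; move/eqP: ij; apply; apply: val_inj; exact: f_inj.
apply: xget_unique => [|k [_ kP]]; first by split=> //; exists e.
by rewrite -(kP e eP) norm.
Qed.

End Kappa.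

Theorem proposition4p6 (R : realType) (I : Type)
    (I_infinite : infinite_set [set: I])
    (H : hilbert R) (H_neq0 : exists x : H, x != 0)
    (v : I -> 'B(H)) (v_car : car_family v) :
  asymp_equiv (fun n => kappa (fermionic v) n) (fun n => Num.sqrt n%:R).
Proof.
exists 1; split=> // n n0.
by rewrite kappa_fermionic// divr1 mul1r lexx.
Qed.
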